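(* Let $(M,g)$ be a Riemannian $n$-manifold with $n\geq 4$, let $A$ denote its Schouten tensor, and let $k=\frac{2(n-1)^2}{2n-3}$. Then $$\mathrm{Ein}_k>0\implies A>0.$$ In particular, the positivity of $\mathrm{Ein}_k$ implies the positivity of all $\Gamma_i(A)$ curvatures for $1\leq i\leq n$.
   Context: $\mathrm{Ein}_k:=\mathrm{Scal}\cdot g-k\,\mathrm{Ric}$, with $\mathrm{Ric}$ and $\mathrm{Scal}$ the Ricci tensor and scalar curvature of $g$. The Schouten tensor is $A=\frac{1}{n-2}\left(\mathrm{Ric}-\frac{\mathrm{Scal}}{2(n-1)}g\right)$. Positivity of a symmetric $2$-tensor means positive definiteness at every point. For a symmetric $2$-tensor $T$, $\sigma_j(T)$ is the $j$-th elementary symmetric function of its eigenvalues with respect to $g$, and $\Gamma_i(T)>0$ means $\sigma_j(T)>0$ for all $1\leq j\leq i$ (at each point). *)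

(* Defs.v *)
From mathcomp Require Import all_boot all_order all_algebra.
From mathcomp Require Import all_classical all_reals all_analysis.

Set Implicit Arguments.
Unset Strict Implicit.
Unset Printing Implicit Defensive.

Import Order.TTheory GRing.Theory Num.Theory.
Import numFieldNormedType.Exports.

Local Open Scope classical_set_scope.
Local Open Scope ring_scope.

Section Calculus.
Context {R : realType} {n : nat}.

Definition partial (i : 'I_n) (f : 'rV[R]_n -> R) : 'rV[R]_n -> R :=
  fun x => 'D_(delta_mx 0 i) f x.

(* f is C^k on the set U, which is open in all uses below. *)
Fixpoint isCk (k : nat) (U : set 'rV[R]_n) (f : 'rV[R]_n -> R) : Prop :=
  {within U, continuous f} /\
  if k is k'.+1 then
    forall i : 'I_n, (forall x, U x -> derivable f x (delta_mx 0 i)) /\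
                     isCk k' U (partial i f)
  else True.

Definition smooth_on (U : set 'rV[R]_n) (f : 'rV[R]_n -> R) : Prop :=
  forall k, isCk k U f.

End Calculus.

Record chart (R : realType) (n : nat) (M : topologicalType) := Chart {
  chart_dom : set M ;
  chart_cod : set 'rV[R]_n ;
  chart_fun :> M -> 'rV[R]_n ;
  chart_inv : 'rV[R]_n -> M ;
  chart_dom_open : open chart_dom ;
  chart_cod_open : open chart_cod ;
  chart_funP : forall p, chart_dom p -> chart_cod (chart_fun p) ;
  chart_invP : forall x, chart_cod x -> chart_dom (chart_inv x) ;
  chart_funK : forall p, chart_dom p -> chart_inv (chart_fun p) = p ;
  chart_invK : forall x, chart_cod x -> chart_fun (chart_inv x) = x ;
  chart_fun_continuous : {within chart_dom, continuous chart_fun} ;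
  chart_inv_continuous : {within chart_cod, continuous chart_inv}
}.

Section Transition.
Context {R : realType} {n : nat} {M : topologicalType}.
Implicit Types c d : chart R n M.

Definition transition c d : 'rV[R]_n -> 'rV[R]_n := d \o chart_inv c.

Definition transition_dom c d : set 'rV[R]_n :=
  chart_cod c `&` chart_inv c @^-1` chart_dom d.

End Transition.

Record smoothManifold (R : realType) (n : nat) := SmoothManifold {
  carrier :> topologicalType ;
  carrier_hausdorff : hausdorff_space carrier ;
  carrier_second_countable : @second_countable carrier ;
  atlas_index : Type ;
  atlas : atlas_index -> chart R n carrier ;
  atlas_cover : forall p : carrier, exists a, chart_dom (atlas a) p ;
  atlas_smooth : forall (a b : atlas_index) (i : 'I_n),
    smooth_on (transition_dom (atlas a) (atlas b))
      (fun x => transition (atlas a) (atlas b) x 0 i)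
}.

(* A 2-tensor field in components: [T a x] is the matrix of the bilinear form
   at the point of coordinates x in the chart a, in the coordinate frame of a;
   its values at x outside the codomain of the chart are irrelevant. *)
Definition tensor2 (R : realType) (n : nat) (M : smoothManifold R n) : Type :=
  atlas_index M -> 'rV[R]_n -> 'M[R]_n.

Definition posdefmx (R : realType) (n : nat) (B : 'M[R]_n) : Prop :=
  forall v : 'rV[R]_n, v != 0 -> 0 < (v *m B *m v^T) 0 0.

Definition tensor_pos (R : realType) (n : nat) (M : smoothManifold R n)
    (T : tensor2 M) : Prop :=
  forall (a : atlas_index M) (x : 'rV[R]_n),
    chart_cod (atlas a) x -> posdefmx (T a x).

(* [jacobian f x i j] is the i-th partial derivative of the j-th component of
   f, so the last field is the usual transformation law of a 2-tensor. *)
Record riemannianMetric (R : realType) (n : nat) (M : smoothManifold R n) :=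
  RiemannianMetric {
  metric : tensor2 M ;
  metric_smooth : forall (a : atlas_index M) (i j : 'I_n),
    smooth_on (chart_cod (atlas a)) (fun x => metric a x i j) ;
  metric_sym : forall (a : atlas_index M) (x : 'rV[R]_n),
    chart_cod (atlas a) x -> (metric a x)^T = metric a x ;
  metric_pos : tensor_pos metric ;
  metric_compat : forall (a b : atlas_index M) (x : 'rV[R]_n),
    transition_dom (atlas a) (atlas b) x ->
    metric a x =
      jacobian (transition (atlas a) (atlas b)) x
      *m metric b (transition (atlas a) (atlas b) x)
      *m (jacobian (transition (atlas a) (atlas b)) x)^T
}.

Section LocalCurvature.
Context {R : realType} {n : nat}.
Variable G : 'rV[R]_n -> 'M[R]_n.

(* Christoffel symbol of the second kind, with upper index l *)
Definition christoffel (l i j : 'I_n) (x : 'rV[R]_n) : R :=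
  2^-1 * \sum_(m < n) invmx (G x) l m *
    (partial i (fun y => G y m j) x + partial j (fun y => G y i m) x
     - partial m (fun y => G y i j) x).

(* the component along d_l of R(d_i, d_j) d_k, where
   R(X, Y) = D_X D_Y - D_Y D_X - D_[X, Y] *)
Definition riemann (l k i j : 'I_n) (x : 'rV[R]_n) : R :=
  partial i (christoffel l j k) x - partial j (christoffel l i k) x
  + \sum_(m < n) (christoffel l i m x * christoffel m j k x
                  - christoffel l j m x * christoffel m i k x).

(* Ric(Y, Z) is the trace of X |-> R(X, Y) Z *)
Definition ricci_mx (x : 'rV[R]_n) : 'M[R]_n :=
  \matrix_(j, k) \sum_(l < n) riemann l k l j x.

Definition scal_fun (x : 'rV[R]_n) : R := \tr (invmx (G x) *m ricci_mx x).

End LocalCurvature.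

Section Curvature.
Context {R : realType} {n : nat} {M : smoothManifold R n}.
Variable g : riemannianMetric M.

Definition Ric : tensor2 M := fun a => ricci_mx (metric g a).

Definition Scal (a : atlas_index M) : 'rV[R]_n -> R := scal_fun (metric g a).

Definition Ein (k : R) : tensor2 M :=
  fun a x => Scal a x *: metric g a x - k *: Ric a x.

Definition Schouten : tensor2 M :=
  fun a x => (n%:R - 2)^-1 *:
    (Ric a x - (Scal a x / (2 * (n%:R - 1))) *: metric g a x).

End Curvature.

Section ElementarySymmetric.
Context {R : realType} {n : nat}.
Implicit Types G B : 'M[R]_n.

(* lam lists, with multiplicity, the eigenvalues of the bilinear form B with
   respect to the inner product G, i.e. those of the endomorphism G^-1 B. *)
Definition is_spectrum G B (lam : {ffun 'I_n -> R}) : Prop :=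
  char_poly (invmx G *m B) = \prod_(i < n) ('X - (lam i)%:P).

(* The default value is only reached when the eigenvalues are not all real,
   which does not happen for B symmetric and G an inner product. *)
Definition spectrum G B : {ffun 'I_n -> R} :=
  xget [ffun=> 0] [set lam | is_spectrum G B lam].

Definition esym (j : nat) (lam : {ffun 'I_n -> R}) : R :=
  \sum_(S : {set 'I_n} | #|S| == j) \prod_(i in S) lam i.

End ElementarySymmetric.

Definition sigma (R : realType) (n : nat) (M : smoothManifold R n)
    (g : riemannianMetric M) (j : nat) (T : tensor2 M)
    (a : atlas_index M) (x : 'rV[R]_n) : R :=
  esym j (spectrum (metric g a x) (T a x)).

Definition Gamma_pos (R : realType) (n : nat) (M : smoothManifold R n)
    (g : riemannianMetric M) (i : nat) (T : tensor2 M) : Prop :=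
  forall (a : atlas_index M) (x : 'rV[R]_n), chart_cod (atlas a) x ->
    forall j : nat, (1 <= j <= i)%N -> 0 < sigma g j T a x.

(* Main.v *)
Require Import Defs.
From mathcomp Require Import all_boot all_order all_algebra.
From mathcomp Require Import all_classical all_reals all_analysis.
From mathcomp Require Import perm complex ring lra.

(* At a point, write s for Scal and fix v != 0. The trace of the positive
   definite form Ein_k with respect to g is (n - k) s, and it exceeds the single
   diagonal term Ein_k(v, v) / g(v, v) = s - k Ric(v, v) / g(v, v). For the
   given k this says exactly Ric(v, v) > s / (2 (n - 1)) g(v, v), i.e. A > 0.

   The eigenvalues of A with respect to g are then positive, and so are their
   elementary symmetric functions. That these eigenvalues are all real requires
   the symmetry of Ric in coordinates: its only term that is not visibly
   symmetric is d_j (Gamma^l_lk) = 1/2 d_j (g^lm d_k g_lm), where Schwarz's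
   theorem is needed. *)

Set Implicit Arguments.
Unset Strict Implicit.
Unset Printing Implicit Defensive.

Import Order.TTheory GRing.Theory Num.Theory.
Import numFieldNormedType.Exports.

Local Open Scope ring_scope.

(** * Positive definite matrices *)

Section PositiveDefinite.
Context {R : realType}.

Lemma posdefmx_unitmx n (G : 'M[R]_n) : posdefmx G -> G \in unitmx.
Proof.
move=> Gpos; rewrite -row_free_unit -kermx_eq0; apply/rowV0P => v.
move=> /sub_kermxP vG; apply/eqP/negPn/negP => v0.
by have := Gpos v v0; rewrite vG mul0mx mxE ltxx.
Qed.

(** A rectangular [V] covers restriction of the form to the span of its rows; row freeness keeps
    nonzero coordinate vectors nonzero in the ambient space. *)
Lemma posdefmx_congr m n (B : 'M[R]_n) (V : 'M[R]_(m, n)) :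
  row_free V -> posdefmx B -> posdefmx (V *m B *m V^T).
Proof.
move=> Vfree Bpos v v0; rewrite !mulmxA -mulmxA -trmx_mul -mulmxA mulmxA.
apply: Bpos; apply: contra_neq v0 => vV0.
by apply: (row_free_inj Vfree); rewrite vV0 mul0mx.
Qed.

Lemma bilinear_sym n (B : 'M[R]_n) (v w : 'rV[R]_n) :
  B^T = B -> (v *m B *m w^T) 0 0 = (w *m B *m v^T) 0 0.
Proof.
move=> Bsym; have -> : v *m B *m w^T = (w *m B *m v^T)^T.
  by rewrite !trmx_mul trmxK Bsym mulmxA.
by rewrite mxE.
Qed.

(* If z = s + it is an eigenvalue of G^-1 A, with eigenvector a + ib after
   multiplication by G^-1, then a A = s a G - t b G and b A = s b G + t a G,
   whence aAa + bAb = s (aGa + bGb) and 0 = aAb - bAa = - t (aGa + bGb). *)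
Lemma relative_eigenvalue_gt0 n (G A : 'M[R]_n) (z : R[i]) :
  G^T = G -> posdefmx G -> A^T = A -> posdefmx A ->
  root (map_poly (real_complex R) (char_poly (invmx G *m A))) z ->
  exists2 s : R, 0 < s & z = real_complex R s.
Proof.
move=> Gsym Gpos Asym Apos.
pose rc := real_complex R.
have Gunit := posdefmx_unitmx Gpos.
rewrite map_char_poly -eigenvalue_root_char => /eigenvalueP[v].
rewrite map_mxM mulmxA map_invmx; set w := v *m _ => wA v0.
have vE : v = w *m map_mx rc G by rewrite /w mulmxKV// map_unitmx.
have w0 : w != 0 by apply: contra_neq v0 => w0; rewrite vE w0 mul0mx.
rewrite vE in wA; clearbody w.
pose a : 'rV[R]_n := map_mx (@complex.Re R) w.
pose b : 'rV[R]_n := map_mx (@complex.Im R) w.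
(* Since [B] is real, taking real or imaginary parts commutes with multiplication by it. *)
have ReM (B : 'M[R]_n) : map_mx (@complex.Re R) (w *m map_mx rc B) = a *m B.
  apply/matrixP => i j; rewrite !mxE raddf_sum; apply: eq_bigr => l _.
  rewrite !mxE; case: (w i l) => x y.
  by rewrite -[LHS]/(x * _ - y * 0) mulr0 subr0.
have ImM (B : 'M[R]_n) : map_mx (@complex.Im R) (w *m map_mx rc B) = b *m B.
  apply/matrixP => i j; rewrite !mxE raddf_sum; apply: eq_bigr => l _.
  rewrite !mxE; case: (w i l) => x y.
  by rewrite -[LHS]/(x * 0 + y * _) mulr0 add0r.
case: z wA => s t wA.
have aA : a *m A = s *: (a *m G) - t *: (b *m G).
  rewrite -ReM wA -ReM -ImM; apply/matrixP => i j; rewrite !mxE.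
  by case: (\sum_(_ < n) _) => x y.
have bA : b *m A = s *: (b *m G) + t *: (a *m G).
  rewrite -ImM wA -ReM -ImM; apply/matrixP => i j; rewrite !mxE.
  by case: (\sum_(_ < n) _) => x y /=; rewrite addrC.
have ge0 (B : 'M[R]_n) (u : 'rV[R]_n) : posdefmx B -> 0 <= (u *m B *m u^T) 0 0.
  move=> Bpos; have [->|/Bpos/ltW//] := eqVneq u 0.
  by rewrite !mul0mx mxE.
have ab0 : a != 0 \/ b != 0.
  have [a0|] := eqVneq a 0; last by left.
  right; apply: contra_neq w0 => b0; apply/matrixP => i j.
  have /matrixP/(_ i j) := a0; have /matrixP/(_ i j) := b0.
  by rewrite !mxE; case: (w i j) => x y /= -> ->.
have gt0 (B : 'M[R]_n) : posdefmx B ->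
    0 < (a *m B *m a^T) 0 0 + (b *m B *m b^T) 0 0.
  move=> Bpos; case: ab0 => /Bpos h.
    by rewrite ltr_wpDr// ge0.
  by rewrite ltr_wpDl// ge0.
have AB (u x y : 'rV[R]_n) (c d : R) :
    ((c *: (x *m G) + d *: (y *m G)) *m u^T) 0 0 =
    c * (x *m G *m u^T) 0 0 + d * (y *m G *m u^T) 0 0.
  by rewrite mulmxDl -!scalemxAl !mxE.
have abA := bilinear_sym a b Asym; have abG := bilinear_sym a b Gsym.
have := gt0 _ Apos; have := gt0 _ Gpos; move: abA.
rewrite aA bA -scaleNr !AB abG => abA Ggt Agt.
have t0 : t = 0.
  apply/eqP; have /eqP : t * ((a *m G *m a^T) 0 0 + (b *m G *m b^T) 0 0) = 0 by lra.
  by rewrite mulf_eq0 (gt_eqF Ggt) orbF.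
exists s; last by rewrite t0.
rewrite -(pmulr_lgt0 _ Ggt); move: Agt; rewrite t0; lra.
Qed.

(** The characteristic polynomial splits over [R[i]], and all its roots are real by
    [relative_eigenvalue_gt0], so the factorization descends to [R]. *)
Lemma exists_spectrum n (G A : 'M[R]_n) :
  G^T = G -> posdefmx G -> A^T = A -> posdefmx A ->
  exists lam, is_spectrum G A lam.
Proof.
move=> Gsym Gpos Asym Apos; set p := char_poly (invmx G *m A).
pose rc := real_complex R.
have [r] := closed_field_poly_normal (map_poly rc p).
rewrite lead_coef_map (monicP (char_poly_monic _)) rmorph1 scale1r => pE.
have rreal z : z \in r -> z = rc (complex.Re z).
  move=> zr; have : root (map_poly rc p) z by rewrite pE root_prod_XsubC.
  by move=> /(relative_eigenvalue_gt0 Gsym Gpos Asym Apos)[s _ ->].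
have sr : size r = n.
  apply: succn_inj; rewrite -(size_prod_XsubC r id) -pE size_map_poly.
  by rewrite size_char_poly.
exists [ffun i : 'I_n => complex.Re r`_i].
rewrite /is_spectrum -/p; apply: (map_poly_inj rc); rewrite pE rmorph_prod /=.
rewrite (big_nth 0) sr big_mkord; apply: eq_bigr => i _.
rewrite ffunE map_polyXsubC; congr ('X - _%:P).
by apply: rreal; rewrite mem_nth ?sr.
Qed.

Lemma spectrum_gt0 n (G A : 'M[R]_n) (lam : {ffun 'I_n -> R}) :
  G^T = G -> posdefmx G -> A^T = A -> posdefmx A ->
  is_spectrum G A lam -> forall i, 0 < lam i.
Proof.
move=> Gsym Gpos Asym Apos lamE i.
have : root (map_poly (real_complex R) (char_poly (invmx G *m A)))
            (real_complex R (lam i)).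
  rewrite fmorph_root lamE -(big_map lam xpredT (fun x => 'X - x%:P)).
  by rewrite root_prod_XsubC map_f// mem_index_enum.
by move=> /(relative_eigenvalue_gt0 Gsym Gpos Asym Apos)[s s0 /complexI ->].
Qed.

Lemma mxtrace_posdef n (G A : 'M[R]_n) : (0 < n)%N ->
  G^T = G -> posdefmx G -> A^T = A -> posdefmx A ->
  0 < \tr (invmx G *m A).
Proof.
move=> n0 Gsym Gpos Asym Apos.
have [lam lamE] := exists_spectrum Gsym Gpos Asym Apos.
have lam0 := spectrum_gt0 Gsym Gpos Asym Apos lamE.
(* The coefficient of degree [n - 1] is minus the trace and, by the factorization, also minus the
   sum of the eigenvalues. *)
have := char_poly_trace (invmx G *m A) n0; rewrite lamE.
rewrite -(big_map lam xpredT (fun x => 'X - x%:P)).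
have szE : size (map lam (index_enum 'I_n)) = n.
  by rewrite size_map -[in RHS](card_ord n) cardT enumT.
have := @coefPn_prod_XsubC _ (map lam (index_enum 'I_n)).
rewrite szE -lt0n => /(_ n0) -> /oppr_inj <-.
rewrite big_map.
case: n n0 lam lam0 {G A Gsym Gpos Asym Apos lamE szE} => // n _ lam lam0.
by rewrite big_ord_recl ltr_pwDl// sumr_ge0// => j _; rewrite ltW.
Qed.

(** A change of basis of both forms only conjugates the endomorphism [invmx G *m B], by [V^T]. *)
Lemma mxtrace_congr n (G B V : 'M[R]_n) : V \in unitmx -> G \in unitmx ->
  \tr (invmx (V *m G *m V^T) *m (V *m B *m V^T)) = \tr (invmx G *m B).
Proof.
move=> Vu Gu; have VTu : V^T \in unitmx by rewrite unitmx_tr.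
set X := V *m G *m V^T.
have Xu : X \in unitmx by rewrite /X !unitmx_mul Vu Gu.
have -> : invmx X = invmx V^T *m invmx G *m invmx V.
  rewrite -[RHS](mulmxK Xu) /X !mulmxA mulmxKV// mulmxKV// mulVmx//.
  by rewrite mul1mx.
by rewrite !mulmxA mulmxKV// mxtrace_mulC !mulmxA mulmxV// mul1mx.
Qed.

(* In a basis that splits the line of v from its G-orthogonal complement, the
   trace is B(v, v) / G(v, v) plus the trace of the restriction of B to the
   complement. *)
Lemma quadratic_lt_trace n (G B : 'M[R]_n) (v : 'rV[R]_n) : (1 < n)%N ->
  G^T = G -> posdefmx G -> B^T = B -> posdefmx B -> v != 0 ->
  (v *m B *m v^T) 0 0 < \tr (invmx G *m B) * (v *m G *m v^T) 0 0.
Proof.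
(* The size [1 + m.+1] leaves a complement of positive dimension, on which the trace is strictly
   positive. *)
case: n G B v => [|[|m]] // G B v _; rewrite -[m.+2]/(1 + m.+1)%N in G B v *.
move=> Gsym Gpos Bsym Bpos v0.
(* Gaussian elimination extends the line of [v] to a basis: as [v] has rank one, it is a multiple of
   the first row [w] of [W]. *)
pose W := row_ebase v; have Wu : W \in unitmx by apply: row_ebase_unit.
pose w := usubmx W.
have [c c0 vE] : exists2 c, c != 0 & v = c *: w.
  have := mulmx_ebase v; rewrite rank_rV v0 => vE.
  have vE' : v = col_ebase v 0 0 *: w.
    rewrite -{1}vE -mulmxA -[row_ebase v]/W -[W]vsubmxK.
    have -> : pid_mx true = row_mx 1%:M 0 :> 'M[R]_(1, 1 + m.+1).
      by rewrite -pid_mx_row.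
    rewrite mul_row_col mul1mx mul0mx addr0.
    by rewrite {1}[col_ebase v]mx11_scalar mul_scalar_mx.
  exists (col_ebase v 0 0) => //.
  by apply: contra_neq v0 => c0; rewrite vE' c0 scale0r.
have w0 : w != 0 by apply: contra_neq v0 => w0; rewrite vE w0 scaler0.
pose al := (w *m G *m w^T) 0 0; have al0 : 0 < al by apply: Gpos.
pose U := dsubmx W.
(* One Gram-Schmidt step: each remaining basis vector loses its [G]-projection onto [w]. The passage
   from [W] to [V] is unipotent, so [V] is still a basis. *)
pose V2 := U - al^-1 *: (U *m G *m w^T *m w).
pose V := col_mx w V2.
have VE : V = block_mx 1%:M 0 (- (al^-1 *: (U *m G *m w^T))) 1%:M *m W.
  rewrite -[W]vsubmxK -/w -/U mul_block_col !mul1mx mul0mx addr0 mulNmx.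
  by rewrite -scalemxAl addrC.
have Vu : V \in unitmx.
  by rewrite VE unitmx_mul Wu andbT unitmxE det_lblock !det1 mulr1 unitr1.
have V2free : row_free V2.
  rewrite -kermx_eq0; apply/rowV0P => u /sub_kermxP uV2.
  have : row_mx (0 : 'rV[R]_1) u *m V = 0 by rewrite mul_row_col mul0mx uV2 addr0.
  move=> /(congr1 (mulmx ^~ (invmx V))); rewrite mulmxK// mul0mx.
  by rewrite -(row_mx0 _ 1 1) => /eq_row_mx[].
have wGw : w *m G *m w^T = al%:M by rewrite [LHS]mx11_scalar.
have V2w : V2 *m G *m w^T = 0.
  rewrite /V2 !mulmxBl -!scalemxAl -!mulmxA [w *m _]mulmxA wGw.
  by rewrite mul_mx_scalar -!scalemxAr scalerA mulVf ?gt_eqF// scale1r subrr.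
have wV2 : w *m G *m V2^T = 0.
  by apply: trmx_inj; rewrite !trmx_mul Gsym trmxK mulmxA V2w trmx0.
pose D := V2 *m G *m V2^T; pose E := V2 *m B *m V2^T.
have VG : V *m G *m V^T = block_mx al%:M 0 0 D.
  by rewrite /V tr_col_mx mul_col_mx mul_col_row wGw V2w wV2.
have VB : V *m B *m V^T =
    block_mx ((w *m B *m w^T) 0 0)%:M (w *m B *m V2^T) (V2 *m B *m w^T) E.
  by rewrite /V tr_col_mx mul_col_mx mul_col_row {1}[w *m B *m w^T]mx11_scalar.
have Dpos : posdefmx D by apply: posdefmx_congr.
have Epos : posdefmx E by apply: posdefmx_congr.
have Dsym : D^T = D by rewrite /D !trmx_mul trmxK Gsym mulmxA.
have Esym : E^T = E by rewrite /E !trmx_mul trmxK Bsym mulmxA.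
have Gu := posdefmx_unitmx Gpos.
(* In the basis [V] the form [G] is block diagonal, so the off-diagonal blocks of [B] do not enter
   the trace, which is B(w, w) / al + tr(D^-1 E). *)
have Tgt : (w *m B *m w^T) 0 0 < \tr (invmx G *m B) * al.
  rewrite -(mxtrace_congr _ Vu Gu) VG VB invmx_block_diag; last first.
    by rewrite -VG !unitmx_mul unitmx_tr Vu Gu.
  rewrite mulmx_block mxtrace_block !mul0mx addr0 add0r invmx_scalar.
  rewrite -scalar_mxM mxtrace_scalar mulr1n mulrDl mulrAC mulVf ?gt_eqF// mul1r.
  by rewrite ltrDl mulr_gt0// mxtrace_posdef.
have qfE (C : 'M[R]_(1 + m.+1)) :
    (v *m C *m v^T) 0 0 = c ^+ 2 * (w *m C *m w^T) 0 0.
  by rewrite vE linearZ /= -!scalemxAl -scalemxAr scalerA !mxE.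
rewrite !qfE mulrCA ltr_pM2l// exprn_even_gt0//=.
Qed.

Lemma esym_gt0 n (lam : {ffun 'I_n -> R}) (j : nat) :
  (forall i, 0 < lam i) -> (j <= n)%N -> 0 < Defs.esym j lam.
Proof.
move=> lam0 jn; rewrite /Defs.esym.
have prod0 (S : {set 'I_n}) : 0 < \prod_(i in S) lam i by apply: prodr_gt0.
(* As [j <= n], some subset of size [j] exists, so the sum of positive terms is not empty. *)
have : (0 < #|[set S : {set 'I_n} | #|S| == j]|)%N.
  by rewrite card_draws card_ord bin_gt0.
move=> /card_gt0P[S]; rewrite inE => Sj.
rewrite (bigD1 S)//= ltr_pwDl// sumr_ge0// => T _; exact: ltW.
Qed.

End PositiveDefinite.

(** * Directional derivatives and Schwarz's theorem *)

Section DirectionalDerivatives.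
Context {R : realType} {V : normedModType R}.
Implicit Types (f : V -> R) (u v x y : V).

(** Restriction to a line turns a directional derivative into a one-variable derivative, to which
    the mean value theorem applies. *)
Lemma is_derive_line f y u (s : R) : derivable f (y + s *: u) u ->
  is_derive s 1 (fun s : R => f (y + s *: u)) ('D_u f (y + s *: u)).
Proof.
have E : (fun h : R => h^-1 *: (((fun s : R => f (y + s *: u)) \o shift s) (h *: 1)
            - f (y + s *: u))) =
         (fun h : R => h^-1 *: ((f \o shift (y + s *: u)) (h *: u)
            - f (y + s *: u))).
  apply/funext => h /=; congr (_ *: (f _ - _)).
  by rewrite [h *: 1]mulr1 scalerDl addrCA addrA addrC addrA.
by move=> df; split; rewrite /derivable /derive E.
Qed.

Lemma MVT_is_derive (g dg : R -> R) (h : R) : 0 < h ->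
  (forall s, 0 <= s <= h -> is_derive s 1 g (dg s)) ->
  exists2 s, 0 < s < h & g h - g 0 = dg s * h.
Proof.
move=> h0 gdg; have [||s] := @MVT R g dg 0 h h0.
- by move=> s; rewrite in_itv/= => /andP[/ltW ? /ltW ?]; apply/gdg/andP.
- apply: derivable_within_continuous => s; rewrite in_itv/=.
  by case/gdg.
- by rewrite in_itv/= subr0 => sh gE; exists s.
Qed.

(** The mean value theorem is applied twice: along [u] to the difference of two translates of [f],
    then along [v] to ['D_u f]. The neighbourhood [Q] serves to bring in continuity at [x] later. *)
Lemma second_difference f u v x (Q : set V) :
  (\forall y \near x, derivable f y u /\ derivable ('D_u f) y v) ->
  nbhs x Q ->
  \forall h \near ((0 : R)^'+)%classic, exists2 z, Q z &
    f (x + h *: u + h *: v) - f (x + h *: u) - f (x + h *: v) + f x =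
    h ^+ 2 * 'D_v ('D_u f) z.
Proof.
move=> df xQ; have [e /= e0 eP] := (nbhs_normP x _).1 (filterI df xQ).
(* For [h * M < e] the whole parallelogram with sides [h *: u] and [h *: v] lies in the ball of
   radius [e]; the summand 1 makes [M] positive even when [u] and [v] vanish. *)
pose M := `|u| + `|v| + 1.
have M0 : 0 < M by rewrite ltr_wpDl// addr_ge0.
have dfP (s t h : R) : 0 <= s <= h -> 0 <= t <= h -> h < e / M ->
    (derivable f (x + s *: u + t *: v) u /\
     derivable ('D_u f) (x + s *: u + t *: v) v) /\ Q (x + s *: u + t *: v).
  move=> /andP[s0 sh] /andP[t0 th]; rewrite ltr_pdivlMr// => hM.
  apply: eP => /=; rewrite -addrA opprD addrA subrr sub0r normrN.
  apply: le_lt_trans hM; rewrite (le_trans (ler_normD _ _))// !normrZ.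
  rewrite (ger0_norm s0) (ger0_norm t0) /M !mulrDr mulr1 ler_wpDr//.
    exact: le_trans sh.
  by rewrite lerD// ler_wpM2r.
near=> h.
have h0 : 0 < h by near: h; exact: nbhs_right_gt.
have hM : h < e / M by near: h; apply: nbhs_right_lt; rewrite divr_gt0.
have hh : 0 <= h <= h by rewrite lexx ltW.
have zh : 0 <= (0 : R) <= h by rewrite lexx ltW.
pose g (s : R) := f (x + h *: v + s *: u) - f (x + s *: u).
have dg s : 0 <= s <= h ->
    is_derive s 1 g ('D_u f (x + s *: u + h *: v) - 'D_u f (x + s *: u)).
  move=> sh.
  have [[d1 _] _] := dfP s h h sh hh hM; have [[d2 _] _] := dfP s 0 h sh zh hM.
  rewrite scale0r addr0 in d2; rewrite addrAC in d1 *.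
  by apply: is_deriveB; apply: is_derive_line.
have [s /andP[s0 sh] gE] := MVT_is_derive h0 dg.
have ssh : 0 <= s <= h by rewrite !ltW.
pose k (t : R) := 'D_u f (x + s *: u + t *: v).
have dk t : 0 <= t <= h -> is_derive t 1 k ('D_v ('D_u f) (x + s *: u + t *: v)).
  by move=> th; apply: is_derive_line; have [[]] := dfP s t h ssh th hM.
have [t /andP[t0 th] kE] := MVT_is_derive h0 dk.
have tth : 0 <= t <= h by rewrite !ltW.
exists (x + s *: u + t *: v); first by have [] := dfP s t h ssh tth hM.
move: gE; rewrite /g; move: kE; rewrite /k !scale0r !addr0 => -> gE.
rewrite mulrC expr2 mulrA -gE (addrAC x); ring.
Unshelve. all: by end_near. Qed.

(* Schwarz's theorem: both iterated derivatives are limits of the second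
   difference of f, which is symmetric in the two directions. *)
Lemma derive_comm f u v x :
  (\forall y \near x, derivable f y u /\ derivable ('D_u f) y v) ->
  (\forall y \near x, derivable f y v /\ derivable ('D_v f) y u) ->
  {for x, continuous ('D_v ('D_u f))} -> {for x, continuous ('D_u ('D_v f))} ->
  'D_v ('D_u f) x = 'D_u ('D_v f) x.
Proof.
move=> duv dvu cuv cvu; apply/eqP; rewrite -subr_eq0 -normr_le0.
apply/ler_addgt0Pl => e e0; rewrite addr0.
have e2 : 0 < e / 2 by rewrite divr_gt0.
have /cvgr_dist_lt/(_ _ e2) n1 := cuv; have /cvgr_dist_lt/(_ _ e2) n2 := cvu.
have D1 := second_difference duv n1; have D2 := second_difference dvu n2.
have [h [/= h0 [[z z1 E1] [w w2 E2]]]] :=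
  filter_ex (filterI (nbhs_right_gt (0 : R)) (filterI D1 D2)).
move: z1 E1 w2 E2; move: ('D_v ('D_u f) z) ('D_u ('D_v f) w) => p q p1 E1 q2 E2.
(* For one and the same [h], both values times [h ^+ 2] are the same second difference. *)
have E : p = q.
  apply: (@mulfI _ (h ^+ 2)); first by rewrite expf_neq0// gt_eqF.
  by rewrite -[LHS]E1 -[RHS]E2 (addrAC x); congr (_ + _); exact: addrAC.
apply: le_trans (ler_distD p _ _) _; rewrite (splitr e) lerD//; first exact: ltW.
by rewrite E distrC; exact: ltW.
Qed.

Lemma derivable_bigprod (I : Type) (r : seq I) (F : I -> V -> R) x v :
  (forall i, derivable (F i) x v) ->
  derivable (fun y => \prod_(i <- r) F i y) x v.
Proof.
move=> dF; elim: r => [|i r IHr].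
  by under eq_fun do rewrite big_nil; exact: (derivable_cst (1 : R)).
under eq_fun do rewrite big_cons; exact: (derivableM (dF i) IHr).
Qed.

Lemma derivable_bigsum (I : Type) (r : seq I) (F : I -> V -> R) x v :
  (forall i, derivable (F i) x v) ->
  derivable (fun y => \sum_(i <- r) F i y) x v.
Proof.
move=> dF; elim: r => [|i r IHr].
  by under eq_fun do rewrite big_nil; exact: (derivable_cst (0 : R)).
under eq_fun do rewrite big_cons; exact: (derivableD (dF i) IHr).
Qed.

Lemma derivable_det n (A : V -> 'M[R]_n) x v :
  (forall i j, derivable (fun y => A y i j) x v) ->
  derivable (fun y => \det (A y)) x v.
Proof.
move=> dA; apply: derivable_bigsum => s.
apply: (derivableM (f := cst ((-1) ^+ s))); first exact: derivable_cst.
exact: derivable_bigprod.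
Qed.

Lemma derivable_invmx n (A : V -> 'M[R]_n) x v :
  (\forall y \near x, A y \in unitmx) ->
  (forall i j, derivable (fun y => A y i j) x v) ->
  forall i j, derivable (fun y => invmx (A y) i j) x v.
Proof.
move=> Au dA i j.
(* Cramer's formula holds only near [x], where [A y] is invertible: elsewhere [invmx] returns its
   argument. *)
apply: (@near_eq_derivable _ _ _ (fun y => (\det (A y))^-1 * \adj (A y) i j)).
  near=> y; have Auy : A y \in unitmx by near: y.
  by rewrite /invmx Auy [RHS]mxE.
have Aux : A x \in unitmx := nbhs_singleton Au.
apply: derivableM.
  by apply: derivableV; [rewrite -unitfE -unitmxE|exact: derivable_det].
rewrite (_ : (fun y => _) = fun y => (-1) ^+ (j + i) * \det (row' j (col' i (A y)))).
  apply: (derivableM (f := cst ((-1) ^+ (j + i)))); first exact: derivable_cst.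
  by apply: derivable_det => a b; under eq_fun do rewrite !mxE; exact: dA.
by apply/funext => y; rewrite mxE.
Unshelve. all: by end_near. Qed.

(** This is the product rule applied to A^-1 A = 1, which is constant near [x]. *)
Lemma derive_invmx n (A : V -> 'M[R]_n) x v :
  (\forall y \near x, A y \in unitmx) ->
  (forall i j, derivable (fun y => A y i j) x v) ->
  \matrix_(i, j) 'D_v (fun y => invmx (A y) i j) x =
  - (invmx (A x) *m \matrix_(i, j) 'D_v (fun y => A y i j) x *m invmx (A x)).
Proof.
move=> Au dA; have dI := derivable_invmx Au dA.
have Aux : A x \in unitmx := nbhs_singleton Au.
rewrite -mulNmx; apply: (canRL (mulmxK Aux)).
apply/eqP; rewrite -addr_eq0; apply/eqP/matrixP => i j.
have : 'D_v (\sum_(k < n) ((fun y => invmx (A y) i k) * (fun y => A y k j))) x = 0.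
  rewrite (@near_eq_derive _ _ _ _ (cst ((1%:M : 'M[R]_n) i j)) x); last first.
    near=> y; have Auy : A y \in unitmx by near: y.
    by rewrite fct_sumE /= -(mulVmx Auy) mxE.
  exact: derive_cst.
rewrite derive_sum; last by move=> k; apply: derivableM.
move=> S; rewrite [LHS]mxE [RHS]mxE -[RHS]S.
rewrite [X in X + _]mxE [X in _ + X]mxE -big_split/=; apply: eq_bigr => k _.
rewrite deriveM// [X in X * _]mxE [X in _ + _ * X]mxE addrC.
by congr (_ + _); exact: mulrC.
Unshelve. all: by end_near. Qed.

End DirectionalDerivatives.

(** * Symmetry of the Ricci tensor *)

Section Smooth.
Context {R : realType} {n : nat} (U : set 'rV[R]_n).
Hypothesis Uopen : open U.

Lemma smooth_derivable (f : 'rV[R]_n -> R) i x :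
  smooth_on U f -> U x -> derivable f x (delta_mx 0 i).
Proof. by move=> /(_ 1%N)[_ /(_ i)[df _]]; exact: df. Qed.

Lemma smooth_partial (f : 'rV[R]_n -> R) i :
  smooth_on U f -> smooth_on U (partial i f).
Proof. by move=> fs k; have [_ /(_ i)[]] := fs k.+1. Qed.

Lemma smooth_continuous (f : 'rV[R]_n -> R) x :
  smooth_on U f -> U x -> {for x, continuous f}.
Proof.
move=> /(_ 0%N)[+ _] Ux; rewrite continuous_open_subspace// => fc.
by apply: fc; rewrite inE.
Qed.

Lemma near_open x : U x -> \forall y \near x, U y.
Proof. by move=> Ux; apply: open_nbhs_nbhs. Qed.

Lemma smooth_partialC (f : 'rV[R]_n -> R) i j x : smooth_on U f -> U x ->
  partial j (partial i f) x = partial i (partial j f) x.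
Proof.
move=> fs Ux; have fsi := smooth_partial i fs; have fsj := smooth_partial j fs.
apply: derive_comm.
- near=> y; have Uy : U y by near: y; exact: near_open.
  by split; [exact: smooth_derivable|exact: smooth_derivable fsi Uy].
- near=> y; have Uy : U y by near: y; exact: near_open.
  by split; [exact: smooth_derivable|exact: smooth_derivable fsj Uy].
- exact: smooth_continuous (smooth_partial j fsi) Ux.
- exact: smooth_continuous (smooth_partial i fsj) Ux.
Unshelve. all: by end_near. Qed.

End Smooth.

Section RicciSymmetry.
Context {R : realType} {n : nat}.
Variables (U : set 'rV[R]_n) (G : 'rV[R]_n -> 'M[R]_n).
Hypothesis Uopen : open U.
Hypothesis Gsmooth : forall i j, smooth_on U (fun x => G x i j).
Hypothesis Gsym : forall x, U x -> (G x)^T = G x.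
Hypothesis Gunit : forall x, U x -> G x \in unitmx.

Lemma metric_symE x i j : U x -> G x i j = G x j i.
Proof. by move=> /Gsym {1}<-; rewrite mxE. Qed.

Lemma invmx_symE x i j : U x -> invmx (G x) i j = invmx (G x) j i.
Proof. by move=> /Gsym {1}<-; rewrite -trmx_inv mxE. Qed.

Lemma partial_metric_sym x k i j : U x ->
  partial k (fun y => G y i j) x = partial k (fun y => G y j i) x.
Proof.
move=> Ux; apply: near_eq_derive.
by near=> y; apply: metric_symE; near: y; exact: near_open.
Unshelve. all: by end_near. Qed.

Lemma near_unitmx x : U x -> \forall y \near x, G y \in unitmx.
Proof.
by move=> Ux; near=> y; apply: Gunit; near: y; exact: near_open.
Unshelve. all: by end_near. Qed.

Lemma derivable_inv_metric x k i j : U x ->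
  derivable (fun y => invmx (G y) i j) x (delta_mx 0 k).
Proof.
move=> Ux; apply: derivable_invmx; first exact: near_unitmx.
by move=> a b; exact: smooth_derivable.
Qed.

Lemma derivable_partial_metric x k l i j : U x ->
  derivable (partial k (fun y => G y i j)) x (delta_mx 0 l).
Proof. by move=> Ux; apply: smooth_derivable Ux; exact: smooth_partial. Qed.

Lemma christoffel_sym x l i j : U x ->
  christoffel G l i j x = christoffel G l j i x.
Proof.
move=> Ux; congr (_ * _); apply: eq_bigr => m _; congr (_ * (_ - _)).
  by rewrite addrC (partial_metric_sym _ _ j)// (partial_metric_sym _ _ i).
exact: partial_metric_sym.
Qed.

Lemma derivable_christoffel x k l i j : U x ->
  derivable (christoffel G l i j) x (delta_mx 0 k).
Proof.
move=> Ux; apply: (derivableM (f := cst 2^-1)); first exact: derivable_cst.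
apply: derivable_bigsum => m; apply: derivableM; first exact: derivable_inv_metric.
apply: derivableB; last exact: derivable_partial_metric.
by apply: derivableD; exact: derivable_partial_metric.
Qed.

(** The other two terms, d_l g_mk - d_m g_lk, are antisymmetric in [l] and [m] and cancel against
    the symmetric inverse metric. *)
Lemma christoffel_contraction x k : U x ->
  \sum_(l < n) christoffel G l l k x =
  2^-1 * \sum_(l < n) \sum_(m < n)
    invmx (G x) l m * partial k (fun y => G y l m) x.
Proof.
move=> Ux; rewrite -mulr_sumr; congr (_ * _).
under eq_bigr do under eq_bigr do rewrite [_ + partial k _ _]addrC -addrA mulrDr.
under eq_bigr do rewrite big_split.
rewrite big_split /= [X in _ + X](_ : _ = 0) ?addr0; last first.
  under eq_bigr do under eq_bigr do rewrite mulrBr.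
  under eq_bigr do rewrite sumrB.
  rewrite sumrB exchange_big/= -sumrB big1// => l _; rewrite -sumrB big1// => m _.
  by rewrite (invmx_symE _ _ Ux) subrr.
by [].
Qed.

(** The product rule isolates two sums whose symmetry in [j] and [k] has different causes: Schwarz's
    theorem for the first, a trace identity for the second. *)
Lemma sum_partial_christoffel x j k : U x ->
  \sum_(l < n) partial j (christoffel G l l k) x =
  2^-1 * (\sum_(l < n) \sum_(m < n)
            invmx (G x) l m * partial j (partial k (fun y => G y l m)) x +
          \sum_(l < n) \sum_(m < n)
            partial k (fun y => G y l m) x *
            partial j (fun y => invmx (G y) l m) x).
Proof.
move=> Ux.
transitivity (partial j (\sum_(l < n) christoffel G l l k) x).
  by rewrite /partial derive_sum// => l; exact: derivable_christoffel.
pose F l m := (fun y => invmx (G y) l m) * partial k (fun y => G y l m).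
have dF l m : derivable (F l m) x (delta_mx 0 j).
  by apply: derivableM;
    [exact: derivable_inv_metric|exact: derivable_partial_metric].
transitivity (partial j (2^-1 \*o \sum_(l < n) \sum_(m < n) F l m) x).
  (* The contraction formula holds on the open set [U] only, which is enough for derivatives at
     [x]. *)
  apply: near_eq_derive; near=> y; have Uy : U y by near: y; exact: near_open.
  rewrite fct_sumE christoffel_contraction//= fct_sumE; congr (_ * _).
  by apply: eq_bigr => l _; rewrite fct_sumE.
rewrite /partial deriveMl; last by do 2!apply: derivable_sum => ?; exact: dF.
rewrite derive_sum; last by move=> l; apply: derivable_sum.
congr (_ * _); rewrite -big_split/=; apply: eq_bigr => l _.
rewrite derive_sum// -big_split/=; apply: eq_bigr => m _; rewrite deriveM//.
  exact: derivable_inv_metric.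
exact: derivable_partial_metric.
Unshelve. all: by end_near. Qed.

(* With d_j (G^-1) = - G^-1 (d_j G) G^-1, this is the symmetry of the trace of
   G^-1 (d_j G) G^-1 (d_k G) in j and k. *)
Lemma partial_inv_metric_sym x j k : U x ->
  \sum_(l < n) \sum_(m < n)
    partial k (fun y => G y l m) x * partial j (fun y => invmx (G y) l m) x =
  \sum_(l < n) \sum_(m < n)
    partial j (fun y => G y l m) x * partial k (fun y => invmx (G y) l m) x.
Proof.
move=> Ux; pose D i : 'M[R]_n := \matrix_(a, b) partial i (fun y => G y a b) x.
suff E i p : \sum_(l < n) \sum_(m < n)
    partial i (fun y => G y l m) x * partial p (fun y => invmx (G y) l m) x =
    - \tr (D i *m invmx (G x) *m D p *m invmx (G x)).
  apply: etrans (E k j) _; apply: etrans (esym (E j k)).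
  move: (D k) (D j) (invmx (G x)) => X Y Z.
  by rewrite -mulmxA mxtrace_mulC mulmxA.
rewrite -raddfN/= -!mulmxA -mulmxN mulmxA -derive_invmx; last 2 first.
- exact: near_unitmx.
- by move=> a b; exact: smooth_derivable.
rewrite exchange_big /mxtrace; apply: eq_bigr => m _; rewrite mxE.
apply: eq_bigr => l _; rewrite !mxE; congr (_ * _).
exact: partial_metric_sym.
Qed.

(** Each of these four sums is separately symmetric in [a] and [b] when [x] lies in [U]. *)
Lemma ricci_mxE x a b :
  ricci_mx G x a b =
  \sum_(l < n) partial l (christoffel G l a b) x
  - \sum_(l < n) partial a (christoffel G l l b) x
  + (\sum_(l < n) \sum_(m < n) christoffel G l l m x * christoffel G m a b x
     - \sum_(l < n) \sum_(m < n) christoffel G l a m x * christoffel G m l b x).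
Proof.
rewrite mxE -!sumrB -big_split/=; apply: eq_bigr => l _.
by rewrite /riemann sumrB.
Qed.

Lemma ricci_sym x : U x -> (ricci_mx G x)^T = ricci_mx G x.
Proof.
move=> Ux; apply/matrixP => a b; rewrite [LHS]mxE ricci_mxE [RHS]ricci_mxE.
have eqBDB (p q r s p' q' r' s' : R) : p = p' -> q = q' -> r = r' -> s = s' ->
    p - q + (r - s) = p' - q' + (r' - s') by move=> -> -> -> ->.
apply: eqBDB.
- apply: eq_bigr => l _; apply: near_eq_derive; near=> y.
  by apply: christoffel_sym; near: y; exact: near_open.
- apply: etrans (sum_partial_christoffel _ _ Ux) _.
  apply: etrans (esym (sum_partial_christoffel _ _ Ux)).
  apply: (f_equal ( *%R 2^-1)); apply: (f_equal2 +%R); last first.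
    exact: partial_inv_metric_sym.
  apply: eq_bigr => l _; apply: eq_bigr => m _; apply: (f_equal ( *%R _)).
  exact: (smooth_partialC Uopen).
- apply: eq_bigr => l _; apply: eq_bigr => m _; apply: (f_equal ( *%R _)).
  exact: christoffel_sym.
(* Swapping the summation indices and the two factors exchanges [a] and [b], up to the lower indices
   of the Christoffel symbols. *)
rewrite exchange_big; apply: eq_bigr => l _; apply: eq_bigr => m _ /=.
by rewrite mulrC; apply: (f_equal2 *%R); exact: christoffel_sym.
Unshelve. all: by end_near. Qed.

End RicciSymmetry.

(** * Pointwise comparison of [Ein] with the Schouten tensor, and conclusion *)

Lemma posdefmx_schouten (R : realType) (n : nat) (G B : 'M[R]_n) (k : R)
    (s := \tr (invmx G *m B)) : (4 <= n)%N ->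
  k = 2 * (n%:R - 1) ^+ 2 / (2 * n%:R - 3) ->
  G^T = G -> posdefmx G -> B^T = B -> posdefmx (s *: G - k *: B) ->
  posdefmx ((n%:R - 2)^-1 *: (B - (s / (2 * (n%:R - 1))) *: G)).
Proof.
move=> n4 kE Gsym Gpos Bsym Epos v v0.
have N4 : 4 <= n%:R :> R by rewrite (ler_nat _ 4).
have Esym : (s *: G - k *: B)^T = s *: G - k *: B.
  by rewrite linearB/= !linearZ/= Gsym Bsym.
have := quadratic_lt_trace (leq_trans (isT : 1 < 4)%N n4) Gsym Gpos Esym Epos v0.
have qB a c (C D : 'M[R]_n) :
    (v *m (a *: C - c *: D) *m v^T) 0 0 =
    a * (v *m C *m v^T) 0 0 - c * (v *m D *m v^T) 0 0.
  by rewrite mulmxBr mulmxBl -!scalemxAr -!scalemxAl !mxE.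
have trE : \tr (invmx G *m (s *: G - k *: B)) = s * n%:R - k * s.
  rewrite mulmxBr linearB/= -!scalemxAr mulVmx ?posdefmx_unitmx//.
  by rewrite !linearZ/= mxtrace1.
rewrite trE qB => ineq.
rewrite -scalemxAr -scalemxAl mxE -[X in X - _ *: G]scale1r qB mul1r.
move: (Gpos v v0) ineq.
move: ((v *m G *m v^T) 0 0) ((v *m B *m v^T) 0 0) => g b g0 ineq.
rewrite mulr_gt0 ?invr_gt0//; first by lra.
move: n%:R N4 kE ineq {trE} => N N4 kE.
have N1 : 0 < N - 1 by lra.
have N3 : 0 < 2 * N - 3 by lra.
have kN : k * (2 * N - 3) = 2 * (N - 1) ^+ 2 by rewrite kE divfK// gt_eqF.
move=> ineq.
(* The trace inequality is multiplied by [2 * N - 3]. The choice of [k] enters through 2(N-1)^2 -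
   (N-1)(2N-3) = N-1, which produces the common factor [N - 1]. *)
have {}ineq : 0 < (N - 1) * (2 * (N - 1) * b - s * g).
  have -> : (N - 1) * (2 * (N - 1) * b - s * g) =
      k * (2 * N - 3) * b - (N - 1) * (s * g) by rewrite kN; ring.
  have -> : N - 1 = k * (2 * N - 3) - (N - 1) * (2 * N - 3) by rewrite kN; ring.
  rewrite (_ : _ - _ = (2 * N - 3) * ((s * N - k * s) * g - (s * g - k * b))).
    by rewrite mulr_gt0// subr_gt0.
  ring.
have : 0 < 2 * (N - 1) * b - s * g by rewrite -(pmulr_rgt0 _ N1).
move=> lt0; have -> : b - s / (2 * (N - 1)) * g =
    (2 * (N - 1) * b - s * g) / (2 * (N - 1)) by field; rewrite gt_eqF.
by rewrite divr_gt0// mulr_gt0.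
Qed.

Theorem proposition2p15 (R : realType) (n : nat) (n_ge4 : (4 <= n)%N)
    (M : smoothManifold R n) (g : riemannianMetric M) (k : R)
    (k_def : k = 2 * (n%:R - 1) ^+ 2 / (2 * n%:R - 3)) :
  (tensor_pos (Ein g k) -> tensor_pos (Schouten g)) /\
  (tensor_pos (Ein g k) ->
   forall i : nat, (1 <= i <= n)%N -> Gamma_pos g i (Schouten g)).
Proof.
have RicT a x : chart_cod (atlas a) x -> (Ric g a x)^T = Ric g a x.
  move=> Ux; apply: ricci_sym Ux; first exact: chart_cod_open.
  - by move=> i j; exact: metric_smooth.
  - by move=> y Uy; exact: (Defs.metric_sym g Uy).
  - by move=> y Uy; apply: posdefmx_unitmx; exact: (metric_pos g Uy).
have Apos : tensor_pos (Ein g k) -> tensor_pos (Schouten g).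
  move=> Epos a x Ux; apply: (posdefmx_schouten n_ge4 k_def).
  - exact: (Defs.metric_sym g Ux).
  - exact: (metric_pos g Ux).
  - exact: RicT.
  - exact: Epos.
split=> // Epos i /andP[_ i_le] a x Ux j /andP[_ j_le].
have AT : (Schouten g a x)^T = Schouten g a x.
  by rewrite /Schouten linearZ/= linearB/= linearZ/= (Defs.metric_sym g Ux) RicT.
have Apx := Apos Epos a x Ux.
have Gpx := metric_pos g Ux; have GT := Defs.metric_sym g Ux.
apply: esym_gt0; last exact: leq_trans j_le i_le.
apply: (spectrum_gt0 GT Gpx AT Apx).
(* A spectrum exists, so [spectrum] returns a genuine one and not its default value. *)
exact: xgetPex (exists_spectrum GT Gpx AT Apx).
Qed.
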